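(* Consider the system $$\begin{cases} C'= \lambda_7 R -(\varepsilon+\beta_1+\lambda_5) C + (\lambda_1+m\lambda_4) P_C+\lambda_2RP_C\\ R'= \lambda_5 C-(\varepsilon+\beta_2+\lambda_7)R + (\lambda_3+m\lambda_4) P_R +(\lambda_2+m_R\lambda_6)RP_R\\ P_C'=(1-\alpha)\gamma + \beta_1 C+ \lambda_7 P_R - (\varepsilon+\lambda_5+\lambda_1+m\lambda_4) P_C - \lambda_2RP_C \\ P_R'=\alpha \gamma + \beta_2 R + \lambda_5 P_C - (\varepsilon+\lambda_7+\lambda_3+m\lambda_4) P_R - (\lambda_2+m_R\lambda_6) RP_R \end{cases}$$ with $\varepsilon>0$, $\lambda_2>0$ and $\lambda_1=\lambda_3=\lambda_4=\lambda_5=\lambda_7=0$, and let $$\tau=\frac{\alpha\gamma(\lambda_2+m_R\lambda_6)}{\varepsilon(\varepsilon+\beta_2)}.$$ (a) If $\tau\le 1$, then there is a unique locally stable equilibrium given by $$(C^*,R^*,P_C^*,P_R^* )=\left(0,0,\frac{\gamma(1-\alpha)}{\varepsilon},\frac{\gamma\alpha}{\varepsilon}\right).$$ (b) If $\tau>1$, then there are two equilibrium solutions: an unstable equilibrium given by $$(C_1^*,R_1^*,P_{C,1}^*,P_{R,1}^* )=\left(0,0,\frac{\gamma(1-\alpha)}{\varepsilon},\frac{\gamma\alpha}{\varepsilon}\right),$$ and a locally stable equilibrium $(C_2^*,R_2^*,P_{C,2}^*,P_{R,2}^* )$ given by $$\left(\frac{\alpha(1-\alpha)\lambda_2\gamma^2\left(1-\frac1\tau\right)}{\varepsilon^2\left(\varepsilon+\beta_1+\lambda_2\left(1-\frac1\tau\right)\right)},\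 \frac{\alpha\gamma\left(1-\frac1\tau\right)}{\varepsilon},\ \frac{(1-\alpha)(\varepsilon+\beta_1)\gamma}{\varepsilon\left(\varepsilon+\beta_1+\lambda_2\left(1-\frac1\tau\right)\right)},\ \frac{\varepsilon+\beta_2}{\lambda_2+m_R\lambda_6}\right).$$
   Context: The system is an autonomous compartmental model of the customers of a corporation: $C$, $R$, $P_C$, $P_R$ are the numbers of regular customers, referral customers, potential regular customers and potential referral customers as functions of time. The parameters $\lambda_1,\dots,\lambda_7$ (transition rates and pull effects), $\beta_1,\beta_2,\varepsilon$ (defection rates), $\gamma$ (recruitment rate) and $m,m_R$ (undifferentiated and referral-directed marketing costs) are nonnegative constants, and $\alpha\in[0,1]$ is the fraction of recruited individuals that are referrals. Solutions are considered with nonnegative initial conditions; an equilibrium solution is a constant solution with nonnegative components.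
   Formalization: In (b), the denominators of the C- and P_C-components of the second equilibrium have λ₂(αγ/ε)(1−1/τ) in place of the printed λ₂(1−1/τ), since the printed point is not an equilibrium in general (e.g. ε=λ₂=1, γ=4, α=1/2, other parameters 0). *)

(* Defs.v *)
From Stdlib Require Import Reals.
From Coquelicot Require Import Coquelicot.
Open Scope R_scope.

(* Solution on [0, T), with T possibly infinite.  Continuity from the right at
   0 together with the equation on (0, T) also yields, when f is continuous,
   the equation at 0 with the one-sided derivative. *)
Definition solution_on {V : NormedModule R_AbsRing}
    (f : V -> V) (T : Rbar) (x : R -> V) : Prop :=
  filterlim x (at_right 0) (locally (x 0)) /\
  forall t, 0 < t -> Rbar_lt t T -> is_derive x t (f (x t)).

Definition is_equilibrium {V : NormedModule R_AbsRing}
    (K : V -> Prop) (f : V -> V) (E : V) : Prop :=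
  K E /\ solution_on f p_infty (fun _ => E).

(* All the stability notions are relative to initial conditions in K.
   Solutions on bounded intervals [0, T) are included, so that a solution
   blowing up in finite time contradicts stability. *)
Definition lyapunov_stable {V : NormedModule R_AbsRing}
    (K : V -> Prop) (f : V -> V) (E : V) : Prop :=
  forall eta : posreal, exists delta : posreal,
  forall (T : Rbar) (x : R -> V),
    solution_on f T x -> K (x 0) -> ball E delta (x 0) ->
    forall t, 0 <= t -> Rbar_lt t T -> ball E eta (x t).

Definition locally_attractive {V : NormedModule R_AbsRing}
    (K : V -> Prop) (f : V -> V) (E : V) : Prop :=
  exists delta : posreal,
  forall x : R -> V,
    solution_on f p_infty x -> K (x 0) -> ball E delta (x 0) ->
    filterlim x (Rbar_locally p_infty) (locally E).

Definition locally_stable {V : NormedModule R_AbsRing}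
    (K : V -> Prop) (f : V -> V) (E : V) : Prop :=
  lyapunov_stable K f E /\ locally_attractive K f E.

Definition unstable {V : NormedModule R_AbsRing}
    (K : V -> Prop) (f : V -> V) (E : V) : Prop := ~ lyapunov_stable K f E.

(* (C, R, P_C, P_R) *)
Definition state : NormedModule R_AbsRing :=
  prod_NormedModule R_AbsRing
    (prod_NormedModule R_AbsRing
       (prod_NormedModule R_AbsRing R_NormedModule R_NormedModule)
       R_NormedModule)
    R_NormedModule.

Definition nonneg_state (x : state) : Prop :=
  let '(c, r, pc, pr) := x in 0 <= c /\ 0 <= r /\ 0 <= pc /\ 0 <= pr.

Definition customer_field
    (lam1 lam2 lam3 lam4 lam5 lam6 lam7 beta1 beta2 eps gamma m mR alpha : R)
    (x : state) : state :=
  let '(c, r, pc, pr) := x in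
  (lam7 * r - (eps + beta1 + lam5) * c + (lam1 + m * lam4) * pc
     + lam2 * r * pc,
   lam5 * c - (eps + beta2 + lam7) * r + (lam3 + m * lam4) * pr
     + (lam2 + mR * lam6) * r * pr,
   (1 - alpha) * gamma + beta1 * c + lam7 * pr
     - (eps + lam5 + lam1 + m * lam4) * pc - lam2 * r * pc,
   alpha * gamma + beta2 * r + lam5 * pc
     - (eps + lam7 + lam3 + m * lam4) * pr - (lam2 + mR * lam6) * r * pr).

(* Main.v *)
Require Import Defs.
From Stdlib Require Import Reals Lra Psatz FunctionalExtensionality.
From Coquelicot Require Import Coquelicot.
Open Scope R_scope.

(** With only the referral rates left, the system is triangular in suitable
coordinates, and every claim reduces to scalar equations.  Write
[k = lambda_2], [L = lambda_2 + m_R lambda_6], [A = alpha gamma],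
[B = (1 - alpha) gamma] and [d = eps + beta_2].

Equilibria: [R' = 0] forces [R = 0] or [L P_R = d], the latter meaning
[R = (tau - 1) d / L]; in each case the remaining equations are linear and
determine the other components ([balanced_unique]).

The totals [C + P_C] and [R + P_R] satisfy [S' = B - eps S] and
[S' = A - eps S], so they relax to [B / eps] and [A / eps] whatever the rest
of the system does.  Relative to an equilibrium, call their deviations [s1]
and [s], and let [z] and [y] be the deviations of [R] and [C].  Then [R]
follows a logistic equation forced only by [s],
   [z' = R (- mu + L (s - z))]  with  [mu = d - L P_R*],
and [C] follows a linear equation forced by [s1] and [z],
   [y' = - (eps + beta_1 + k R) y + k (R s1 + P_C* z)]
(lemma [perturbation_of_solution]).  Since [R >= 0] along solutions
([nonneg_of_growth_rate]) and [mu R* = 0] at an equilibrium, the condition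
[mu >= 0] makes each equation dissipative as soon as its unknown dominates its
forcing.  This bounds the deviations by a multiple of their initial size
([perturbation_bound]) and makes them vanish at infinity
([perturbation_limit]).  Hence every equilibrium with [L P_R* <= d] is locally
stable ([locally_stable_of_balanced]).  At the equilibrium without customers
the condition reads [tau <= 1], critical case included; at the other
equilibrium it is an equality.

The two tools for scalar functions are a barrier lemma (a function that does
not increase while above a level never crosses it) and its quantitative form
(one that decreases at a definite rate while above a level ends up below it).
Applied to squares, they replace explicit solution formulas and comparison
theorems.

For [tau > 1], instability is witnessed by explicit solutions: both
totals are started at their limits, so that [R] is an exact logistic function
growing from an arbitrarily small value to a fixed height, and [C] solves a
scalar linear equation ([referral_free_unstable]). *)

(** * Scalar differential inequalities *)

(** Continuity is two-sided even at time 0, unlike in [solution_on]: functions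
are thought of as already extended to negative times, which makes the
mean value and extreme value theorems on intervals [[0, b]] directly usable.
The derivative [du] is an arbitrary function of time, so one notion serves for
autonomous and forced equations. *)
Definition evolves (u du : R -> R) (T : Rbar) : Prop :=
  (forall t, 0 <= t -> Rbar_lt t T -> continuous u t) /\
  (forall t, 0 < t -> Rbar_lt t T -> is_derive u t (du t)).

Lemma Rbar_le_lt_lt (a b : R) (T : Rbar) :
  a <= b -> Rbar_lt b T -> Rbar_lt a T.
Proof. destruct T; simpl; intros; try lra; auto. Qed.

Lemma evolves_affine (a b k : R) (u v du dv dw : R -> R) (T : Rbar) :
  evolves u du T -> evolves v dv T ->
  (forall t, 0 < t -> Rbar_lt t T -> dw t = a * du t + b * dv t) ->
  evolves (fun t => a * u t + b * v t + k) dw T.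
Proof.
intros [cu Du] [cv Dv] Hw; split.
- intros t t0 tT.
  apply (continuous_plus (fun s => a * u s + b * v s) (fun _ => k));
    [|apply continuous_const].
  apply (continuous_plus (fun s => a * u s) (fun s => b * v s)).
  + apply (continuous_scal_r a u), cu; assumption.
  + apply (continuous_scal_r b v), cv; assumption.
- intros t t0 tT; rewrite Hw by assumption.
  replace (a * du t + b * dv t) with (plus (plus (a * du t) (b * dv t)) 0)
    by (unfold plus; simpl; ring).
  apply (is_derive_plus (fun s => a * u s + b * v s) (fun _ => k));
    [|apply (is_derive_const k)].
  apply (is_derive_plus (fun s => a * u s) (fun s => b * v s)).
  + apply (is_derive_scal u); apply Du; assumption.
  + apply (is_derive_scal v); apply Dv; assumption.
Qed.

Lemma evolves_mult (u v du dv dw : R -> R) (T : Rbar) :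
  evolves u du T -> evolves v dv T ->
  (forall t, 0 < t -> Rbar_lt t T -> dw t = du t * v t + u t * dv t) ->
  evolves (fun t => u t * v t) dw T.
Proof.
intros [cu Du] [cv Dv] Hw; split; intros t t0 tT.
- apply (continuous_mult u v); [apply cu | apply cv]; assumption.
- rewrite Hw by assumption.
  apply (is_derive_mult u v t (du t) (dv t)); auto.
  intros; apply Rmult_comm.
Qed.

(** If [u b > M], consider the last time [s] before [b] with [u s <= M].  On
[(s, b]] the function is above [M], hence nonincreasing, so [u b <= u t] for
[t] close to [s]; continuity at [s] gives a contradiction. *)
Lemma barrier (u du : R -> R) (T : Rbar) (a b M : R) :
  evolves u du T -> 0 <= a <= b -> Rbar_lt b T -> u a <= M ->
  (forall t, a < t <= b -> M < u t -> du t <= 0) ->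
  u b <= M.
Proof.
intros [cu Du] [a0 ab] bT ua Hdu.
destruct (Rle_or_lt (u b) M) as [H|ub]; [exact H|exfalso].
set (E := fun t => a <= t <= b /\ u t <= M).
destruct (completeness E) as [s [sup least]].
{ exists b; intros t [Ht _]; lra. }
{ exists a; split; lra. }
assert (as_ : a <= s) by (apply sup; split; lra).
assert (sb : s <= b) by (apply least; intros t [Ht _]; lra).
assert (cs : continuous u s)
  by (apply cu; [lra | apply Rbar_le_lt_lt with b; assumption]).
assert (near : forall e, 0 < e -> exists d, 0 < d /\
          forall t, Rabs (t - s) < d -> Rabs (u t - u s) < e).
{ intros e He.
  destruct (proj1 (filterlim_locally u (u s)) cs (mkposreal e He)) as [d Hd].
  exists d; split; [apply cond_pos|]; intros t Ht; exact (Hd t Ht). }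
assert (us : u s <= M).
{ destruct (Rle_or_lt (u s) M) as [H|us]; [exact H|exfalso].
  destruct (near (u s - M)) as [d [d0 Hd]]; [lra|].
  assert (s <= s - d / 2); [|lra].
  apply least; intros t [Ht Hut].
  destruct (Rle_or_lt t (s - d / 2)) as [H|H]; [exact H|exfalso].
  assert (ts : t <= s) by (apply sup; split; assumption).
  assert (Hn : Rabs (u t - u s) < u s - M)
    by (apply Hd; apply Rabs_def1; lra).
  apply Rabs_def2 in Hn; lra. }
assert (sb' : s < b) by (destruct (Rle_lt_or_eq_dec s b sb); subst; lra).
assert (above : forall t, s < t <= b -> M < u t).
{ intros t Ht; destruct (Rle_or_lt (u t) M) as [H|H]; [|exact H].
  assert (t <= s); [apply sup; split|]; lra. }
destruct (near (u b - u s)) as [d [d0 Hd]]; [lra|].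
(* The mean value theorem is used on [t, b] rather than [s, b] because [du] is
   not controlled at s itself. *)
set (t := s + Rmin (d / 2) ((b - s) / 2)).
assert (0 < Rmin (d / 2) ((b - s) / 2)) by (apply Rmin_glb_lt; lra).
pose proof (Rmin_l (d / 2) ((b - s) / 2)).
pose proof (Rmin_r (d / 2) ((b - s) / 2)).
assert (st : s < t < b) by (unfold t; lra).
assert (Hn : Rabs (u t - u s) < u b - u s)
  by (apply Hd; unfold t; apply Rabs_def1; lra).
apply Rabs_def2 in Hn.
destruct (MVT_gen u t b du) as [c [Hc Hmv]];
  rewrite ?Rmin_left, ?Rmax_right in * by lra.
- intros y Hy; apply Du; [lra|].
  apply Rbar_le_lt_lt with b; [lra | assumption].
- intros y Hy; apply continuity_pt_filterlim, cu; [lra|].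
  apply Rbar_le_lt_lt with b; [lra | assumption].
- assert (du c <= 0) by (apply Hdu; [lra | apply above; lra]).
  nra.
Qed.

(** While above [M] the function loses at least [c] per unit of time, so it
must reach [M] by the time [b] at which the excess of [u a] would be exhausted;
from then on the barrier lemma keeps it below. *)
Lemma eventually_le_of_descent (u du : R -> R) (M c : R) :
  evolves u du p_infty -> 0 < c ->
  Rbar_locally p_infty (fun t => M < u t -> du t <= - c) ->
  Rbar_locally p_infty (fun t => u t <= M).
Proof.
intros Hu c0 [a0 Ha0].
set (a := Rmax 0 (a0 + 1)).
assert (a1 : 0 <= a) by apply Rmax_l.
assert (a2 : a0 + 1 <= a) by apply Rmax_r.
set (b := a + Rmax 0 (u a - M) / c).
assert (0 <= Rmax 0 (u a - M) / c)
  by (apply Rdiv_le_0_compat; [apply Rmax_l | assumption]).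
assert (hit : exists t, a <= t /\ u t <= M).
{ destruct (Rle_or_lt (u a) M) as [H1|H1]; [exists a; split; lra|].
  exists b; split; [unfold b; lra|].
  assert (len : c * (b - a) = u a - M)
    by (unfold b; rewrite Rmax_right by lra; field; lra).
  destruct (Rle_or_lt (u b) M) as [H2|H2]; [exact H2|].
  assert (id : evolves (fun t => t) (fun _ => 1) p_infty).
  { split; intros; [apply continuous_id | apply (@is_derive_id R_AbsRing)]. }
  (* Were u above M at the final time b, u would have been above M throughout
     [a, b], by the barrier lemma. *)
  assert (stay : forall t, a <= t <= b -> M < u t).
  { intros t Ht; destruct (Rle_or_lt (u t) M) as [H3|H3]; [exfalso|exact H3].
    assert (u b <= M); [|lra].
    apply (barrier u du p_infty t b M Hu); simpl; auto; try lra.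
    intros r Hr Hur; assert (du r <= - c); [apply Ha0; lra | lra]. }
  assert (1 * u b + c * b + (- c * a) <= u a); [|lra].
  apply (barrier (fun t => 1 * u t + c * t + (- c * a))
           (fun t => du t + c) p_infty a b).
  - apply (evolves_affine 1 c _ u (fun t => t) du (fun _ => 1)); auto.
    intros; ring.
  - unfold b; lra.
  - exact I.
  - lra.
  - intros t Ht _. assert (du t <= - c); [|lra].
    apply Ha0; [lra | apply stay; lra]. }
destruct hit as [t1 [Ht1 Hu1]].
exists t1; intros t Ht.
apply (barrier u du p_infty t1 t M Hu); simpl; auto; try lra.
intros r Hr Hur; assert (du r <= - c); [apply Ha0; lra | lra].
Qed.

Lemma Rabs_le_square (x M : R) : 0 <= M -> (Rabs x <= M <-> x * x <= M * M).
Proof.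
intros HM; rewrite <- (Rabs_pos_eq M HM) at 1; split; intros H.
- apply Rsqr_le_abs_1; assumption.
- apply Rsqr_le_abs_0; assumption.
Qed.

(** The barrier lemma for [u ^ 2], whose derivative is [2 u u']: both signs of
[u] are treated at once. *)
Lemma abs_barrier (u du : R -> R) (T : Rbar) (M : R) :
  evolves u du T -> Rabs (u 0) <= M ->
  (forall t, 0 < t -> Rbar_lt t T -> M < Rabs (u t) -> u t * du t <= 0) ->
  forall t, 0 <= t -> Rbar_lt t T -> Rabs (u t) <= M.
Proof.
intros Hu u0 Hdu t t0 tT.
assert (M0 : 0 <= M) by (pose proof (Rabs_pos (u 0)); lra).
apply Rabs_le_square; [assumption|].
apply (barrier (fun t => u t * u t) (fun t => 2 * (u t * du t)) T 0 t); auto.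
- apply (evolves_mult u u du du); auto; intros; ring.
- lra.
- apply Rabs_le_square; assumption.
- intros r Hr Hur; assert (u r * du r <= 0); [|lra].
  apply Hdu; [lra | apply Rbar_le_lt_lt with t; tauto |].
  apply Rnot_le_lt; rewrite Rabs_le_square; lra.
Qed.

Lemma is_lim_0_spec (u : R -> R) :
  is_lim u p_infty 0 <->
  forall eta, 0 < eta -> Rbar_locally p_infty (fun t => Rabs (u t) <= eta).
Proof.
rewrite <- is_lim_spec; split; intros H.
- intros eta He; destruct (H (mkposreal eta He)) as [a Ha].
  exists a; intros t Ht; specialize (Ha t Ht); simpl in Ha.
  rewrite Rminus_0_r in Ha; lra.
- intros [eta He]; destruct (H (eta / 2)) as [a Ha]; [lra|].
  exists a; intros t Ht; specialize (Ha t Ht); simpl.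
  rewrite Rminus_0_r; lra.
Qed.

(** Only the behaviour of [u u'] for late times and outside a given
neighbourhood of 0 matters, and the rate [c] may depend on the neighbourhood.
This covers both exponential decay and the merely algebraic decay of the
critical case [u' = - u ^ 2]. *)
Lemma is_lim_0_of_dissipation (u du : R -> R) :
  evolves u du p_infty ->
  (forall eta, 0 < eta -> exists c, 0 < c /\
     Rbar_locally p_infty (fun t => eta < Rabs (u t) -> u t * du t <= - c)) ->
  is_lim u p_infty 0.
Proof.
intros Hu H; apply is_lim_0_spec; intros eta He.
destruct (H eta He) as [c [c0 Hc]].
assert (HH : Rbar_locally p_infty (fun t => u t * u t <= eta * eta)).
{ apply (eventually_le_of_descent (fun t => u t * u t)
            (fun t => 2 * (u t * du t)) _ (2 * c)).
  - apply (evolves_mult u u du du); auto; intros; ring.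
  - lra.
  - revert Hc; apply filter_imp; intros t Ht Hut.
    assert (u t * du t <= - c); [apply Ht | lra].
    apply Rnot_le_lt; rewrite Rabs_le_square; lra. }
revert HH; apply filter_imp; intros t; apply Rabs_le_square; lra.
Qed.

(** On a compact interval the rate [h] has a maximum [H], and [- u exp(- H t)]
does not increase while it is positive. *)
Lemma nonneg_of_growth_rate (u h : R -> R) (T : Rbar) :
  evolves u (fun t => u t * h t) T ->
  (forall t, 0 <= t -> Rbar_lt t T -> continuous h t) ->
  0 <= u 0 -> forall t, 0 <= t -> Rbar_lt t T -> 0 <= u t.
Proof.
intros Hu ch u0 b b0 bT.
destruct (continuity_ab_maj h 0 b) as [m [Hm _]]; [assumption| |].
{ intros t Ht; apply continuity_pt_filterlim, ch; [lra|].
  apply Rbar_le_lt_lt with b; tauto. }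
assert (Hw : evolves (fun t => - exp (- h m * t))
               (fun t => h m * exp (- h m * t)) T).
{ assert (D : forall t, is_derive (fun t => - exp (- h m * t)) t
                (h m * exp (- h m * t)))
    by (intros t; auto_derive; auto; ring).
  split; intros t _ _; [|apply D].
  apply (ex_derive_continuous (fun t => - exp (- h m * t))).
  eexists; apply D. }
assert (Hb : u b * - exp (- h m * b) <= 0).
{ apply (barrier (fun t => u t * - exp (- h m * t))
     (fun t => (u t * - exp (- h m * t)) * (h t - h m)) T 0 b); auto.
  - apply (evolves_mult _ _ _ _ _ _ Hu Hw); intros; ring.
  - lra.
  - pose proof (exp_pos (- h m * 0)); nra.
  - intros t Ht Hpos; assert (h t <= h m) by (apply Hm; lra); nra. }
pose proof (exp_pos (- h m * b)); nra.
Qed.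

(** * The reduced system *)

(** The vector field of the system once the vanishing rates are removed;
[k] and [L] are the pull rates towards regular and referral customers. *)
Definition referral_field (k L e b1 b2 A B : R) (x : state) : state :=
  let '(c, r, p, q) := x in
  (k * r * p - (e + b1) * c,
   L * r * q - (e + b2) * r,
   B + b1 * c - e * p - k * r * p,
   A + b2 * r - e * q - L * r * q).

Definition regular (x : state) : R := fst (fst (fst x)).
Definition referral (x : state) : R := snd (fst (fst x)).
Definition potential_regular (x : state) : R := snd (fst x).
Definition potential_referral (x : state) : R := snd x.

(** A solution is extended to negative times by its initial value through
[Rmax 0], which turns right-continuity at 0 into continuity. *)
Lemma solution_evolves (f : state -> state) (l : state -> R) (T : Rbar)
    (x : R -> state) :
  @is_linear R_AbsRing state R_NormedModule l -> solution_on f T x ->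
  evolves (fun t => l (x (Rmax 0 t))) (fun t => l (f (x (Rmax 0 t)))) T.
Proof.
intros Hl [x0 Dx].
assert (D : forall t, 0 < t -> Rbar_lt t T ->
            is_derive (fun t => x (Rmax 0 t)) t (f (x (Rmax 0 t)))).
{ intros t t0 tT; rewrite Rmax_right by lra.
  apply (is_derive_ext_loc x); [|apply Dx; assumption].
  exists (mkposreal t t0); intros s Hs.
  apply Rabs_def2 in Hs; simpl in Hs; unfold minus, plus, opp in Hs;
    simpl in Hs.
  rewrite Rmax_right by lra; reflexivity. }
split.
- intros t t0 tT.
  apply (continuous_comp (fun t => x (Rmax 0 t)) l).
  2:{ apply (filterdiff_continuous l); exists l.
      apply (filterdiff_linear l); assumption. }
  destruct (Rle_lt_or_eq_dec 0 t t0) as [tpos|<-].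
  { apply (ex_derive_continuous (fun t => x (Rmax 0 t))).
    eexists; apply D; assumption. }
  intros P HP; rewrite Rmax_left in HP by lra.
  destruct (x0 P HP) as [d Hd].
  exists d; intros s Hs.
  destruct (Rle_or_lt s 0) as [s0|s0].
  + rewrite Rmax_left by lra; apply (locally_singleton _ _ HP).
  + rewrite Rmax_right by lra; apply Hd; assumption.
- intros t t0 tT.
  specialize (D t t0 tT).
  pose proof (filterdiff_comp' _ l _ _ l D
                (filterdiff_linear l Hl)) as H.
  unfold is_derive.
  eapply filterdiff_ext_lin; [exact H|].
  intros s; exact (linear_scal l Hl s (f (x (Rmax 0 t)))).
Qed.

Lemma is_linear_components :
  (@is_linear R_AbsRing state R_NormedModule regular /\
   @is_linear R_AbsRing state R_NormedModule referral) /\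
  (@is_linear R_AbsRing state R_NormedModule potential_regular /\
   @is_linear R_AbsRing state R_NormedModule potential_referral).
Proof.
assert (H1 := @is_linear_fst R_AbsRing
  (prod_NormedModule R_AbsRing (prod_NormedModule R_AbsRing R_NormedModule
     R_NormedModule) R_NormedModule) R_NormedModule).
assert (H2 := is_linear_comp _ _ H1 (@is_linear_fst R_AbsRing
  (prod_NormedModule R_AbsRing R_NormedModule R_NormedModule)
     R_NormedModule)).
split; split.
- exact (is_linear_comp _ _ H2 is_linear_fst).
- exact (is_linear_comp _ _ H2 is_linear_snd).
- exact (is_linear_comp _ _ H1 is_linear_snd).
- exact is_linear_snd.
Qed.

(** * Dynamics of the deviations from an equilibrium *)

(** The triangular system for the deviations from an equilibrium whose
referral and potential regular components are [rs] and [ps]: [s1] and [s]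
belong to the totals [C + P_C] and [R + P_R], [z] to [R] and [y] to [C].  Thus
[rs + z] is [R], [b] is the total loss rate of [C], and [mu] is the net
per-capita loss rate of [R] at the equilibrium. *)
Record perturbation (k L e b mu rs ps : R) (T : Rbar)
    (s1 s z y : R -> R) : Prop := {
  regular_total : evolves s1 (fun t => - e * s1 t) T;
  referral_total : evolves s (fun t => - e * s t) T;
  referral_gap :
    evolves z (fun t => (rs + z t) * (- mu + L * (s t - z t))) T;
  regular_gap :
    evolves y (fun t => - (b + k * (rs + z t)) * y t
                 + k * ((rs + z t) * s1 t + ps * z t)) T;
  referral_nonneg : forall t, 0 <= t -> Rbar_lt t T -> 0 <= rs + z t }.

Lemma Rmult_le_Rabs (x y : R) : x * y <= Rabs x * Rabs y.
Proof. rewrite <- Rabs_mult; apply Rle_abs. Qed.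

Lemma Rabs_square (x : R) : Rabs x * Rabs x = x * x.
Proof. rewrite <- Rabs_mult; apply Rabs_pos_eq; nra. Qed.

(** Writing [z = (rs + z) - rs] turns the contribution of [mu] into
[- mu (rs + z) ^ 2 + mu rs (rs + z)], whose second term vanishes. *)
Lemma referral_gap_dissipation (L mu rs s z : R) :
  0 <= mu -> mu * rs = 0 ->
  z * ((rs + z) * (- mu + L * (s - z))) <= L * ((rs + z) * (z * s - z * z)).
Proof.
intros mu0 murs.
replace (z * ((rs + z) * (- mu + L * (s - z)))) with
  (L * ((rs + z) * (z * s - z * z))
   - mu * ((rs + z) * (rs + z)) + mu * rs * (rs + z)) by ring.
rewrite murs.
assert (0 <= mu * ((rs + z) * (rs + z)))
  by (apply Rmult_le_pos; [assumption | apply Rle_0_sqr]).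
lra.
Qed.

Lemma damped_linear_dissipation (a b g y : R) :
  b <= a -> y * (- a * y + g) <= - Rabs y * (b * Rabs y - Rabs g).
Proof.
intros ba.
pose proof (Rmult_le_Rabs y g).
replace (y * (- a * y + g)) with (y * g - a * (Rabs y * Rabs y))
  by (rewrite Rabs_square; ring).
assert (0 <= (a - b) * (Rabs y * Rabs y))
  by (apply Rmult_le_pos; [lra | rewrite Rabs_square; apply Rle_0_sqr]).
lra.
Qed.

(** Each deviation moves towards 0 whenever it exceeds the level allowed by the
deviations that force it: [z] is driven by [s] with gain 1, and the forcing of
[y] is at most [k (rs + 1 + ps) rho], to be compared with the damping [b].
The assumption [rho <= 1] serves to linearize this last bound. *)
Lemma perturbation_bound (k L e b mu rs ps : R) (T : Rbar)
    (s1 s z y : R -> R) (rho : R) :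
  0 < k -> 0 < L -> 0 < e -> 0 < b -> 0 <= mu -> 0 <= rs -> 0 <= ps ->
  mu * rs = 0 ->
  perturbation k L e b mu rs ps T s1 s z y ->
  rho <= 1 ->
  Rabs (s1 0) <= rho -> Rabs (s 0) <= rho -> Rabs (z 0) <= rho ->
  Rabs (y 0) <= rho ->
  forall t, 0 <= t -> Rbar_lt t T ->
  (Rabs (s1 t) <= rho /\ Rabs (s t) <= rho) /\
  (Rabs (z t) <= rho /\ Rabs (y t) <= (1 + k * (rs + 1 + ps) / b) * rho).
Proof.
intros k0 L0 e0 b0 mu0 rs0 ps0 murs [Hs1 Hs Hz Hy Hr] rho1 Is1 Is Iz Iy.
assert (rho0 : 0 <= rho) by (pose proof (Rabs_pos (z 0)); lra).
assert (Bs1 : forall t, 0 <= t -> Rbar_lt t T -> Rabs (s1 t) <= rho)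
  by (apply (abs_barrier _ _ _ _ Hs1 Is1); intros; nra).
assert (Bs : forall t, 0 <= t -> Rbar_lt t T -> Rabs (s t) <= rho)
  by (apply (abs_barrier _ _ _ _ Hs Is); intros; nra).
assert (Bz : forall t, 0 <= t -> Rbar_lt t T -> Rabs (z t) <= rho).
{ apply (abs_barrier _ _ _ _ Hz Iz); intros t t0 tT zt.
  assert (st := Bs t (Rlt_le _ _ t0) tT).
  assert (rt := Hr t (Rlt_le _ _ t0) tT).
  apply Rle_trans with (1 := referral_gap_dissipation L mu rs _ _ mu0 murs).
  assert (sz : z t * s t <= z t * z t).
  { apply Rle_trans with (1 := Rmult_le_Rabs _ _).
    rewrite <- (Rabs_square (z t)).
    apply Rmult_le_compat_l; [apply Rabs_pos | lra]. }
  assert (0 <= L * ((rs + z t) * (z t * z t - z t * s t)))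
    by (apply Rmult_le_pos; nra).
  nra. }
set (K := k * (rs + 1 + ps) / b).
assert (K0 : 0 <= K) by (apply Rdiv_le_0_compat; nra).
assert (By : forall t, 0 <= t -> Rbar_lt t T ->
              Rabs (y t) <= (1 + K) * rho).
{ apply (abs_barrier _ _ _ _ Hy); [nra|]; intros t t0 tT yt.
  assert (s1t := Bs1 t (Rlt_le _ _ t0) tT).
  assert (zt := Bz t (Rlt_le _ _ t0) tT).
  assert (rt := Hr t (Rlt_le _ _ t0) tT).
  set (g := k * ((rs + z t) * s1 t + ps * z t)).
  assert (Hg : Rabs g <= b * K * rho).
  { replace (b * K * rho) with (k * ((rs + 1) * rho + ps * rho))
      by (unfold K; field; lra).
    unfold g; rewrite Rabs_mult, (Rabs_pos_eq k) by lra.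
    apply Rmult_le_compat_l; [lra|].
    apply Rle_trans with (1 := Rabs_triang _ _).
    rewrite 2!Rabs_mult, (Rabs_pos_eq ps), (Rabs_pos_eq (rs + z t)) by lra.
    apply Rplus_le_compat; [|nra].
    apply Rmult_le_compat; try apply Rabs_pos; try lra.
    pose proof (Rle_abs (z t)); lra. }
  assert (kr : b <= b + k * (rs + z t)) by nra.
  apply Rle_trans with (1 := damped_linear_dissipation _ b g (y t) kr).
  assert (0 <= Rabs (y t) * (b * Rabs (y t) - Rabs g))
    by (apply Rmult_le_pos; [apply Rabs_pos | nra]).
  lra. }
intros t t0 tT; split; split; auto.
Qed.

Lemma is_lim_relaxation (e : R) (u : R -> R) :
  0 < e -> evolves u (fun t => - e * u t) p_infty -> is_lim u p_infty 0.
Proof.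
intros e0 Hu; apply (is_lim_0_of_dissipation _ _ Hu); intros eta He.
exists (e * (eta * eta)); split; [apply Rmult_lt_0_compat; nra|].
exists 0; intros t _ Ht.
assert (eta * eta < u t * u t)
  by (apply Rnot_le_lt; rewrite <- Rabs_le_square; lra).
nra.
Qed.

(** The order of convergence follows the triangular structure.  The damping of
[z] is proportional to [R = rs + z], which must be kept away from 0 while
[|z|] is not small.  If [rs = 0] then [R = z] and this is automatic; if
[rs > 0] the trajectory has to stay near the equilibrium, since the solutions
with [R = 0] do not converge to it. *)
Lemma perturbation_limit (k L e b mu rs ps : R)
    (s1 s z y : R -> R) :
  0 < k -> 0 < L -> 0 < e -> 0 < b -> 0 <= mu -> 0 <= rs ->
  mu * rs = 0 ->
  perturbation k L e b mu rs ps p_infty s1 s z y ->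
  (rs = 0 \/ forall t, 0 <= t -> Rabs (z t) <= rs / 2) ->
  (is_lim s1 p_infty 0 /\ is_lim s p_infty 0) /\
  (is_lim z p_infty 0 /\ is_lim y p_infty 0).
Proof.
intros k0 L0 e0 b0 mu0 rs0 murs [Hs1 Hs Hz Hy Hr] near.
assert (Ls1 := is_lim_relaxation e s1 e0 Hs1).
assert (Ls := is_lim_relaxation e s e0 Hs).
assert (Lz : is_lim z p_infty 0).
{ apply (is_lim_0_of_dissipation _ _ Hz); intros eta He.
  assert (lower : exists r0, 0 < r0 /\ forall t, 0 <= t ->
            eta < Rabs (z t) -> r0 <= rs + z t).
  { destruct (Req_dec rs 0) as [r0|r0].
    - exists eta; split; [assumption|]; intros t t0 zt.
      assert (H := Hr t t0 I).
      rewrite Rabs_pos_eq in zt by lra; lra.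
    - exists (rs / 2); split; [lra|]; intros t t0 _.
      destruct near as [near|near]; [contradiction|].
      pose proof (Rle_abs (- z t)) as H; rewrite Rabs_Ropp in H.
      specialize (near t t0); lra. }
  destruct lower as [r0 [r0pos Hr0]].
  exists (L * (r0 * (eta * eta / 2))).
  assert (0 < eta * eta / 2) by nra.
  split; [apply Rmult_lt_0_compat; nra|].
  assert (es : Rbar_locally p_infty (fun t => Rabs (s t) <= eta / 2))
    by (apply (proj1 (is_lim_0_spec s)); [assumption | lra]).
  assert (et : Rbar_locally p_infty (fun t => 0 <= t))
    by (exists 0; intros; lra).
  generalize (filter_and _ _ es et); apply filter_imp; intros t [st t0] zt.
  assert (rt := Hr0 t t0 zt).
  assert (sz : z t * s t <= z t * z t / 2).
  { apply Rle_trans with (1 := Rmult_le_Rabs _ _).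
    rewrite <- (Rabs_square (z t)).
    pose proof (Rabs_pos (z t)); nra. }
  assert (zz : eta * eta <= z t * z t)
    by (apply Rlt_le, Rnot_le_lt; rewrite <- Rabs_le_square; lra).
  apply Rle_trans with (1 := referral_gap_dissipation L mu rs _ _ mu0 murs).
  assert (L * (r0 * (eta * eta / 2)) <=
          L * ((rs + z t) * (z t * z t - z t * s t))); [|lra].
  apply Rmult_le_compat_l; [lra|].
  apply Rmult_le_compat; lra. }
assert (Lr : is_lim (fun t => rs + z t) p_infty (rs + 0))
  by (apply is_lim_plus'; [apply is_lim_const | assumption]).
set (g := fun t => k * ((rs + z t) * s1 t + ps * z t)).
assert (Lg : is_lim g p_infty 0).
{ replace 0 with (k * ((rs + 0) * 0 + ps * 0)) by ring.
  apply (is_lim_scal_l _ k p_infty ((rs + 0) * 0 + ps * 0)).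
  apply is_lim_plus'.
  - apply (is_lim_mult _ _ p_infty (rs + 0) 0); auto; exact I.
  - apply (is_lim_scal_l _ ps p_infty 0); assumption. }
split; [split; assumption | split; [assumption|]].
apply (is_lim_0_of_dissipation _ _ Hy); intros eta He.
exists (b * (eta * eta / 2)); split; [apply Rmult_lt_0_compat; nra|].
assert (eg : Rbar_locally p_infty (fun t => Rabs (g t) <= b * eta / 2))
  by (apply (proj1 (is_lim_0_spec g)); [assumption | nra]).
assert (et : Rbar_locally p_infty (fun t => 0 <= t))
  by (exists 0; intros; lra).
generalize (filter_and _ _ eg et); apply filter_imp; intros t [gt t0] yt.
assert (rt := Hr t t0 I); fold (g t).
assert (kr : b <= b + k * (rs + z t)) by nra.
apply Rle_trans with (1 := damped_linear_dissipation _ b (g t) (y t) kr).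
assert (eta * (b * eta / 2) <= Rabs (y t) * (b * Rabs (y t) - Rabs (g t)))
  by (apply Rmult_le_compat; nra).
lra.
Qed.

(** The existence time [T] is arbitrary, so that the bounds obtained for the
deviations also exclude blow-up. *)
Lemma perturbation_of_solution (k L e b1 b2 A B cs rs ps qs : R) (T : Rbar)
    (x : R -> state) :
  k * rs * ps = (e + b1) * cs ->
  e * (cs + ps) = B -> e * (rs + qs) = A ->
  solution_on (referral_field k L e b1 b2 A B) T x -> nonneg_state (x 0) ->
  exists s1 s z y,
    perturbation k L e (e + b1) (e + b2 - L * qs) rs ps T s1 s z y /\
    forall t, 0 <= t ->
      x t = (cs + y t, rs + z t, ps + (s1 t - y t), qs + (s t - z t)).
Proof.
intros Ec ES1 ES sol x0.
destruct is_linear_components as [[lc lr] [lp lq]].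
assert (Hc := solution_evolves _ _ _ _ lc sol).
assert (Hr := solution_evolves _ _ _ _ lr sol).
assert (Hp := solution_evolves _ _ _ _ lp sol).
assert (Hq := solution_evolves _ _ _ _ lq sol).
assert (ef : forall v, referral_field k L e b1 b2 A B v =
  (k * referral v * potential_regular v - (e + b1) * regular v,
   L * referral v * potential_referral v - (e + b2) * referral v,
   B + b1 * regular v - e * potential_regular v
     - k * referral v * potential_regular v,
   A + b2 * referral v - e * potential_referral v
     - L * referral v * potential_referral v))
  by (intros [[[? ?] ?] ?]; reflexivity).
set (c := fun t => regular (x (Rmax 0 t))) in *.
set (r := fun t => referral (x (Rmax 0 t))) in *.
set (p := fun t => potential_regular (x (Rmax 0 t))) in *.
set (q := fun t => potential_referral (x (Rmax 0 t))) in *.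
assert (r_nonneg : forall t, 0 <= t -> Rbar_lt t T -> 0 <= r t).
{ apply (nonneg_of_growth_rate r (fun t => L * q t - (e + b2))).
  - split; [apply Hr|]; intros t t0 tT.
    replace (r t * (L * q t - (e + b2))) with
      (referral (referral_field k L e b1 b2 A B (x (Rmax 0 t)))); [apply Hr; assumption|].
    rewrite ef; unfold r, q; cbn; ring.
  - intros t t0 tT.
    apply (continuous_minus (fun t => L * q t) (fun _ => e + b2));
      [|apply continuous_const].
    apply (continuous_scal_r L q), Hq; assumption.
  - unfold r; rewrite Rmax_left by lra.
    destruct (x 0) as [[[c0 r0] p0] q0]; cbn in *; tauto. }
(* The unit and zero coefficients put each deviation in the affine form
   of evolves_affine. *)
exists (fun t => 1 * c t + 1 * p t + - (cs + ps)),
  (fun t => 1 * r t + 1 * q t + - (rs + qs)),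
  (fun t => 1 * r t + 0 * r t + - rs),
  (fun t => 1 * c t + 0 * c t + - cs).
split.
- split.
  + apply (evolves_affine _ _ _ _ _ _ _ _ _ Hc Hp); intros t t0 tT.
    rewrite ef; unfold c, p; cbn. rewrite <- ES1; ring.
  + apply (evolves_affine _ _ _ _ _ _ _ _ _ Hr Hq); intros t t0 tT.
    rewrite ef; unfold r, q; cbn; rewrite <- ES; ring.
  + apply (evolves_affine _ _ _ _ _ _ _ _ _ Hr Hr); intros t t0 tT.
    rewrite ef; unfold r, q; cbn; ring.
  + apply (evolves_affine _ _ _ _ _ _ _ _ _ Hc Hc); intros t t0 tT.
    rewrite ef; unfold c, r, p; cbn.
    match goal with |- ?u = ?v =>
      replace u with (v + (k * rs * ps - (e + b1) * cs) * -1) by ring end.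
    rewrite Ec; ring.
  + intros t t0 tT; replace (rs + _) with (r t) by ring; auto.
- intros t t0; unfold c, r, p, q; rewrite Rmax_right by lra.
  destruct (x t) as [[[ct rt] pt] qt]; cbn.
  change R in (type of ct), (type of rt), (type of pt), (type of qt).
  apply f_equal2; [apply f_equal2; [apply f_equal2|]|];
    match goal with |- @eq _ ?u ?v => change (@eq R u v) end; ring.
Qed.

(** * Equilibria and their stability *)

(** The equations for a zero of the field, with the last two components
replaced by the balances of the totals: this is the form in which they
simplify the deviations and in which they are solved. *)
Definition balanced (k L e b1 b2 A B : R) (E : state) : Prop :=
  let '(c, r, p, q) := E in
  k * r * p = (e + b1) * c /\ r * (L * q - (e + b2)) = 0 /\
  e * (c + p) = B /\ e * (r + q) = A.

Lemma is_equilibrium_iff_balanced (k L e b1 b2 A B : R) (E : state) :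
  is_equilibrium nonneg_state (referral_field k L e b1 b2 A B) E <->
  nonneg_state E /\ balanced k L e b1 b2 A B E.
Proof.
set (f := referral_field k L e b1 b2 A B).
split; intros [HK HE]; split; try assumption.
- assert (z : forall l : state -> R,
             @is_linear R_AbsRing state R_NormedModule l -> l (f E) = 0).
  { intros l Hl; destruct (solution_evolves f l _ _ Hl HE) as [_ D].
    specialize (D 1 Rlt_0_1 I); apply is_derive_unique in D.
    rewrite <- D; apply Derive_const. }
  destruct is_linear_components as [[lc lr] [lp lq]].
  assert (zc := z _ lc); assert (zr := z _ lr).
  assert (zp := z _ lp); assert (zq := z _ lq).
  destruct E as [[[c r] p] q]; cbn in zc, zr, zp, zq; cbn.
  repeat split; lra.
- split; [apply filterlim_const|]; intros t _ _.
  replace (f E) with (zero : state); [apply is_derive_const|].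
  destruct E as [[[c r] p] q]; destruct HE as [Hc [Hr [Hp Hq]]].
  unfold f, referral_field.
  assert (H1 : k * r * p - (e + b1) * c = 0) by lra.
  assert (H2 : L * r * q - (e + b2) * r = 0) by lra.
  assert (H3 : B + b1 * c - e * p - k * r * p = 0) by lra.
  assert (H4 : A + b2 * r - e * q - L * r * q = 0) by lra.
  rewrite H1, H2, H3, H4; reflexivity.
Qed.

(** Once [R] is known, the balances give [P_R] and the sum [C + P_C], and then
[C] solves the linear equation [(e + b1 + k R) C = k R (C + P_C)]. *)
Lemma balanced_unique (k L e b1 b2 A B c c' r p p' q q' : R) :
  0 < k -> 0 < e -> 0 <= b1 -> 0 <= r ->
  balanced k L e b1 b2 A B (c, r, p, q) ->
  balanced k L e b1 b2 A B (c', r, p', q') ->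
  (c, r, p, q) = (c', r, p', q').
Proof.
intros k0 e0 b0 r0 [H1 [_ [H3 H4]]] [H1' [_ [H3' H4']]].
assert (cp : c + p = c' + p') by (apply Rmult_eq_reg_l with e; lra).
assert (rq : r + q = r + q') by (apply Rmult_eq_reg_l with e; lra).
assert (kr : 0 <= k * r) by nra.
assert (cc : c = c').
{ apply Rmult_eq_reg_l with (e + b1 + k * r); [|lra].
  replace ((e + b1 + k * r) * c) with (k * r * (c + p)) by lra.
  rewrite cp; lra. }
subst c'; replace p' with p by lra; replace q' with q by lra; reflexivity.
Qed.

Lemma ball_state (c r p q c' r' p' q' d : R) :
  ball ((c, r, p, q) : state) d ((c', r', p', q') : state) <->
  ((Rabs (c' - c) < d /\ Rabs (r' - r) < d) /\ Rabs (p' - p) < d) /\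
  Rabs (q' - q) < d.
Proof. split; intros H; exact H. Qed.

(** The condition [L q <= e + b2] says that, at the equilibrium, a referral
customer recruits at most at the rate at which referral customers are lost. *)
Lemma locally_stable_of_balanced (k L e b1 b2 A B c r p q : R) :
  0 < k -> 0 < L -> 0 < e -> 0 <= b1 ->
  nonneg_state (c, r, p, q) -> balanced k L e b1 b2 A B (c, r, p, q) ->
  L * q <= e + b2 ->
  locally_stable nonneg_state (referral_field k L e b1 b2 A B) (c, r, p, q).
Proof.
intros k0 L0 e0 b0 [_ [r0 [p0 _]]] [Hc [Hr [Hp Hq]]] sub.
assert (b0' : 0 < e + b1) by lra.
assert (mu0 : 0 <= e + b2 - L * q) by lra.
assert (mur : (e + b2 - L * q) * r = 0) by lra.
set (K := 1 + k * (r + 1 + p) / (e + b1)).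
assert (K1 : 1 <= K).
{ assert (0 <= k * (r + 1 + p) / (e + b1)); [|unfold K; lra].
  apply Rdiv_le_0_compat; [apply Rmult_le_pos|]; lra. }
(* The halved radius absorbs the sums c + p and r + q of two components. *)
assert (close : forall (T : Rbar) (x : R -> state) (rho : R),
  rho <= 1 -> solution_on (referral_field k L e b1 b2 A B) T x ->
  nonneg_state (x 0) -> ball ((c, r, p, q) : state) (rho / 2) (x 0) ->
  exists s1 s z y,
    perturbation k L e (e + b1) (e + b2 - L * q) r p T s1 s z y /\
    (forall t, 0 <= t -> x t = (c + y t, r + z t, p + (s1 t - y t), q + (s t - z t))) /\
    forall t, 0 <= t -> Rbar_lt t T ->
    (Rabs (s1 t) <= rho /\ Rabs (s t) <= rho) /\
    (Rabs (z t) <= rho /\ Rabs (y t) <= K * rho)).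
{ intros T x rho rho1 sol x0 near.
  destruct (perturbation_of_solution _ _ _ _ _ _ _ _ _ _ _ _ _
              Hc Hp Hq sol x0) as [s1 [s [z [y [pert Hx]]]]].
  exists s1, s, z, y; split; [assumption|]; split; [assumption|].
  rewrite (Hx 0 (Rle_refl 0)), ball_state in near.
  destruct near as [[[Ny Nz] Np] Nq].
  apply Rabs_def2 in Ny; apply Rabs_def2 in Nz.
  apply Rabs_def2 in Np; apply Rabs_def2 in Nq.
  apply (perturbation_bound k L e (e + b1) (e + b2 - L * q) r p T);
    try assumption; apply Rabs_le; lra. }
split.
- intros eta.
  set (rho := Rmin 1 (eta / (2 * (K + 1)))).
  assert (rho0 : 0 < rho).
  { apply Rmin_glb_lt; [lra|].
    apply Rdiv_lt_0_compat; [apply cond_pos | lra]. }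
  assert (rhoK : (K + 1) * rho < eta).
  { apply Rle_lt_trans with ((K + 1) * (eta / (2 * (K + 1)))).
    - apply Rmult_le_compat_l; [lra | apply Rmin_r].
    - replace ((K + 1) * (eta / (2 * (K + 1)))) with (eta / 2)
        by (field; lra).
      pose proof (cond_pos eta); lra. }
  assert (h0 : 0 < rho / 2) by lra.
  exists (mkposreal _ h0); intros T x sol x0 near t t0 tT.
  destruct (close T x rho (Rmin_l _ _) sol x0 near)
    as [s1 [s [z [y [_ [Hx Bd]]]]]].
  destruct (Bd t t0 tT) as [[B1 B2] [B3 B4]].
  apply Rabs_le_between in B1; apply Rabs_le_between in B2.
  apply Rabs_le_between in B3; apply Rabs_le_between in B4.
  rewrite (Hx t t0), ball_state.
  assert (rho <= K * rho) by nra.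
  repeat split; apply Rabs_def1; lra.
- (* For r > 0, the radius keeps the referral component above r / 2. *)
  set (rho := if Req_EM_T r 0 then 1 else Rmin 1 (r / 2)).
  assert (Hrho : 0 < rho <= 1 /\ (r = 0 \/ rho <= r / 2)).
  { unfold rho; destruct (Req_EM_T r 0).
    - split; [lra | left; assumption].
    - split; [split; [apply Rmin_glb_lt; lra | apply Rmin_l]|].
      right; apply Rmin_r. }
  destruct Hrho as [[rho0 rho1] rhor].
  assert (h0 : 0 < rho / 2) by lra.
  exists (mkposreal _ h0); intros x sol x0 near.
  destruct (close p_infty x rho rho1 sol x0 near)
    as [s1 [s [z [y [pert [Hx Bd]]]]]].
  destruct (perturbation_limit _ _ _ _ _ _ _ _ _ _ _
              k0 L0 e0 b0' mu0 r0 mur pert) as [[L1 L2] [L3 L4]].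
  { destruct rhor as [|rhor]; [left; assumption|right]; intros t t0.
    destruct (Bd t t0 I) as [_ [B3 _]]; lra. }
  apply (filterlim_ext_loc (fun t => (c + y t, r + z t,
           p + (s1 t - y t), q + (s t - z t)) : state)).
  { exists 0; intros t t0; rewrite Hx; [reflexivity | lra]. }
  assert (lim : forall v u : R -> R, forall a : R, is_lim u p_infty 0 ->
    (forall t, v t = a + u t) ->
    filterlim v (Rbar_locally p_infty) (locally a)).
  { intros v u a Hu Hv; apply (filterlim_ext (fun t => a + u t)); [auto|].
    assert (H : is_lim (fun t => a + u t) p_infty (a + 0))
      by (apply is_lim_plus'; [apply is_lim_const | assumption]).
    rewrite Rplus_0_r in H; exact H. }
  assert (diff : forall u v, is_lim u p_infty 0 -> is_lim v p_infty 0 ->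
     is_lim (fun t => u t - v t) p_infty 0).
  { intros u v Hu Hv.
    assert (H := is_lim_minus' _ _ p_infty 0 0 Hu Hv).
    rewrite Rminus_0_r in H; exact H. }
  apply filterlim_locally; intros eps.
  assert (F1 := proj1 (filterlim_locally _ _) (lim _ _ c L4 (fun _ => eq_refl)) eps).
  assert (F2 := proj1 (filterlim_locally _ _) (lim _ _ r L3 (fun _ => eq_refl)) eps).
  assert (F3 := proj1 (filterlim_locally _ _)
                  (lim _ _ p (diff _ _ L1 L4) (fun _ => eq_refl)) eps).
  assert (F4 := proj1 (filterlim_locally _ _)
                  (lim _ _ q (diff _ _ L2 L3) (fun _ => eq_refl)) eps).
  generalize (filter_and _ _ (filter_and _ _ (filter_and _ _ F1 F2) F3) F4).
  apply filter_imp; intros t H; exact H.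
Qed.

(** * Instability of the equilibrium without customers *)

Lemma primitive_exists (a : R -> R) :
  (forall t, continuous a t) ->
  exists I : R -> R, I 0 = 0 /\ forall t, is_derive I t (a t).
Proof.
intros Ha; exists (RInt a 0); split; [exact (RInt_point 0 a)|]; intros t.
apply (is_derive_RInt a (RInt a 0) 0 t); [|apply Ha].
apply filter_forall; intros s; apply (@RInt_correct R_CompleteNormedModule).
apply (@ex_RInt_continuous R_CompleteNormedModule); intros; apply Ha.
Qed.

(** Variation of constants, [y t = exp(- I t) int_0^t exp(I) g] with
[I' = a]. *)
Lemma linear_ode_solution (a g : R -> R) :
  (forall t, continuous a t) -> (forall t, continuous g t) ->
  exists y : R -> R, y 0 = 0 /\
    forall t, is_derive y t (- a t * y t + g t).
Proof.
intros Ha Hg.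
destruct (primitive_exists a Ha) as [I [_ DI]].
destruct (primitive_exists (fun t => exp (I t) * g t)) as [J [J0 DJ]].
{ intros t; apply (continuous_mult (fun t => exp (I t)) g); [|apply Hg].
  apply (ex_derive_continuous (fun t => exp (I t))).
  auto_derive; eexists; apply DI. }
exists (fun t => exp (- I t) * J t); split; [rewrite J0; ring|].
intros t; auto_derive.
{ repeat split; eexists; [apply DI | apply DJ]. }
assert (eI : Derive (fun t => I t) t = a t)
  by (apply is_derive_unique, DI).
assert (eJ : Derive (fun t => J t) t = exp (I t) * g t)
  by (apply is_derive_unique, DJ).
rewrite eI, eJ, exp_Ropp; field; apply Rgt_not_eq, exp_pos.
Qed.

Lemma is_derive_pair {U V : NormedModule R_AbsRing} (u : R -> U) (v : R -> V)
    (t : R) (du : U) (dv : V) :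
  is_derive u t du -> is_derive v t dv ->
  @is_derive R_AbsRing (prod_NormedModule R_AbsRing U V)
    (fun s => (u s, v s)) t (du, dv).
Proof.
intros Hu Hv.
apply (filterdiff_comp'_2 u v (fun a b => (a, b) : prod_NormedModule R_AbsRing U V)
  t _ _ (fun a b => (a, b)) Hu Hv).
apply (filterdiff_ext_lin _ (fun w => w)); [|intros [? ?]; reflexivity].
apply (filterdiff_ext (fun w => w)); [intros [? ?]; reflexivity|].
apply filterdiff_id.
Qed.

(** On the invariant set where both totals are at their limits, [R] satisfies
the logistic equation [R' = R (mu - L R)] with [mu > 0], so that [1 / R] is
[/ rs + w0 exp(- mu t)] with [rs = mu / L].  However large [w0] is, [R] reaches
[rs / 2], which refutes stability for the radius [rs / 2]. *)
Lemma referral_free_unstable (k L e b1 b2 A B : R) :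
  0 < k -> 0 < L -> 0 < e -> 0 <= b2 -> 0 <= B ->
  e + b2 < L * (A / e) ->
  unstable nonneg_state (referral_field k L e b1 b2 A B)
    (0, 0, B / e, A / e).
Proof.
intros k0 L0 e0 b20 B0 super stable.
set (mu := L * (A / e) - (e + b2)).
assert (mu0 : 0 < mu) by (unfold mu; lra).
set (rs := mu / L).
assert (rs0 : 0 < rs) by (apply Rdiv_lt_0_compat; assumption).
assert (Lrs : L * rs = mu) by (unfold rs; field; lra).
assert (h0 : 0 < rs / 2) by lra.
destruct (stable (mkposreal _ h0)) as [[d d0] Hd]; simpl in Hd.
(* The summand / d makes r 0 < d; the summand / rs makes r 0 < rs / 2, so that
   the level rs / 2 is reached at a nonnegative time. *)
set (w0 := / d + / rs).
assert (id0 := Rinv_0_lt_compat _ d0); assert (irs0 := Rinv_0_lt_compat _ rs0).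
assert (w00 : 0 < w0) by (unfold w0; lra).
set (w := fun t => / rs + w0 * exp (- mu * t)).
assert (wpos : forall t, / rs < w t).
{ intros t; pose proof (exp_pos (- mu * t)); unfold w; nra. }
set (r := fun t => / w t).
assert (r0 : forall t, 0 < r t < rs).
{ intros t; specialize (wpos t); split.
  - apply Rinv_0_lt_compat; lra.
  - rewrite <- (Rinv_inv rs); apply Rinv_lt_contravar; [nra | assumption]. }
assert (Dr : forall t, is_derive r t (r t * (mu - L * r t))).
{ intros t; specialize (wpos t); unfold r, w; auto_derive.
  - unfold w in wpos; lra.
  - rewrite <- Lrs; unfold w; field; split; [lra|].
    pose proof (exp_pos (- (L * rs) * t)) as He.
    assert (0 < w0 * exp (- (L * rs) * t) * rs); [|lra].
    apply Rmult_lt_0_compat; [apply Rmult_lt_0_compat|]; assumption. }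
assert (cr : forall t, continuous r t)
  by (intros t; apply (ex_derive_continuous r); eexists; apply Dr).
destruct (linear_ode_solution (fun t => e + b1 + k * r t)
            (fun t => k * (B / e) * r t)) as [y [y0 Dy]].
{ intros t; apply (continuous_plus (fun _ => e + b1) (fun t => k * r t)).
  - apply continuous_const.
  - apply (continuous_scal_r k r), cr. }
{ intros t; apply (continuous_scal_r (k * (B / e)) r), cr. }
set (x := fun t => (y t, r t, B / e - y t, A / e - r t) : state).
assert (Dx : forall t, is_derive x t
          (referral_field k L e b1 b2 A B (x t))).
{ intros t; unfold x, referral_field.
  assert (Cst : forall (u : R -> R) du a, is_derive u t du ->
            is_derive (fun t => a - u t) t (- du)).
  { intros u du a Hu; replace (- du) with (minus 0 du)
      by (unfold minus, plus, opp; simpl; ring).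
    apply (is_derive_minus (fun _ => a) u); [apply (is_derive_const a) | assumption]. }
  repeat apply is_derive_pair.
  - replace (k * r t * (B / e - y t) - (e + b1) * y t) with
      (- (e + b1 + k * r t) * y t + k * (B / e) * r t) by ring.
    apply Dy.
  - replace (L * r t * (A / e - r t) - (e + b2) * r t) with
      (r t * (mu - L * r t)) by (unfold mu; ring).
    apply Dr.
  - replace (B + _ - _ - _) with
      (- (- (e + b1 + k * r t) * y t + k * (B / e) * r t)) by (field; lra).
    apply Cst, Dy.
  - replace (A + _ - _ - _) with
      (- (r t * (mu - L * r t))) by (unfold mu; field; lra).
    apply Cst, Dr. }
(* At this time w0 exp(- mu t) = / rs. *)
set (t := ln (w0 * rs) / mu).
assert (w0rs : 1 < w0 * rs).
{ unfold w0; rewrite Rmult_plus_distr_r, Rinv_l by lra.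
  assert (0 < / d * rs) by (apply Rmult_lt_0_compat; lra); lra. }
assert (t0 : 0 <= t).
{ apply Rdiv_le_0_compat; [|assumption].
  rewrite <- ln_1; apply ln_le; lra. }
assert (rt : r t = rs / 2).
{ unfold r, w, t.
  replace (- mu * (ln (w0 * rs) / mu)) with (- ln (w0 * rs)) by (field; lra).
  rewrite exp_Ropp, exp_ln by lra; field; lra. }
assert (Hx : ball ((0, 0, B / e, A / e) : state) (rs / 2) (x t)).
{ apply (Hd p_infty x); [| | |assumption|exact I].
  - split; [|intros s _ _; apply Dx].
    apply (filterlim_filter_le_1 (F := locally 0)).
    + intros P [eps HP]; exists eps; intros s Hs _; apply HP, Hs.
    + apply (ex_derive_continuous x); eexists; apply Dx.
  - unfold x, nonneg_state; rewrite y0; destruct (r0 0).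
    assert (rs < A / e).
    { apply Rmult_lt_reg_l with L; [assumption|]; rewrite Lrs; unfold mu; lra. }
    assert (0 <= B / e) by (apply Rdiv_le_0_compat; assumption).
    repeat split; lra.
  - unfold x; rewrite ball_state, y0; destruct (r0 0).
    assert (r 0 < d).
    { unfold r, w; rewrite Rmult_0_r, exp_0, Rmult_1_r.
      rewrite <- (Rinv_inv d); apply Rinv_lt_contravar;
        [apply Rmult_lt_0_compat|]; unfold w0; lra. }
    repeat split; apply Rabs_def1; lra. }
unfold x in Hx; rewrite ball_state, rt in Hx.
destruct Hx as [[[_ Hx] _] _]; apply Rabs_def2 in Hx; lra.
Qed.

(** * The threshold theorem *)

Theorem theorem4
  (lam1 lam2 lam3 lam4 lam5 lam6 lam7 beta1 beta2 eps gamma m mR alpha : R)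
  (hlam1 : lam1 = 0) (hlam2 : 0 < lam2) (hlam3 : lam3 = 0) (hlam4 : lam4 = 0)
  (hlam5 : lam5 = 0) (hlam6 : 0 <= lam6) (hlam7 : lam7 = 0)
  (hbeta1 : 0 <= beta1) (hbeta2 : 0 <= beta2) (heps : 0 < eps)
  (hgamma : 0 <= gamma) (hm : 0 <= m) (hmR : 0 <= mR)
  (halpha : 0 <= alpha <= 1) :
  let f := customer_field lam1 lam2 lam3 lam4 lam5 lam6 lam7
             beta1 beta2 eps gamma m mR alpha in
  let tau := alpha * gamma * (lam2 + mR * lam6) / (eps * (eps + beta2)) in
  let E1 : state :=
    (0, 0, gamma * (1 - alpha) / eps, gamma * alpha / eps) in
  let E2 : state :=
    (alpha * (1 - alpha) * lam2 * gamma ^ 2 * (1 - 1 / tau)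
       / (eps ^ 2
          * (eps + beta1 + lam2 * (alpha * gamma / eps) * (1 - 1 / tau))),
     alpha * gamma * (1 - 1 / tau) / eps,
     (1 - alpha) * (eps + beta1) * gamma
       / (eps * (eps + beta1 + lam2 * (alpha * gamma / eps) * (1 - 1 / tau))),
     (eps + beta2) / (lam2 + mR * lam6)) in
  (tau <= 1 ->
     (forall E : state, is_equilibrium nonneg_state f E <-> E = E1) /\
     locally_stable nonneg_state f E1) /\
  (1 < tau ->
     (forall E : state,
        is_equilibrium nonneg_state f E <-> E = E1 \/ E = E2) /\
     E1 <> E2 /\
     unstable nonneg_state f E1 /\
     locally_stable nonneg_state f E2).
Proof.
intros f tau E1 E2.
set (L := lam2 + mR * lam6) in *.
set (A := alpha * gamma) in *.
set (B := (1 - alpha) * gamma).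
set (d := eps + beta2) in *.
assert (L0 : 0 < L) by (unfold L; nra).
assert (d0 : 0 < d) by (unfold d; lra).
assert (A0 : 0 <= A) by (unfold A; nra).
assert (B0 : 0 <= B) by (unfold B; nra).
assert (ef : f = referral_field lam2 L eps beta1 beta2 A B).
{ apply functional_extensionality; intros [[[c r] p] q].
  unfold f, customer_field, referral_field, A, B, L; subst.
  apply f_equal2; [apply f_equal2; [apply f_equal2|]|];
    match goal with |- @eq _ ?u ?v => change (@eq R u v) end; ring. }
assert (eE1 : E1 = (0, 0, B / eps, A / eps)).
{ unfold E1, A, B; rewrite (Rmult_comm gamma (1 - alpha)),
    (Rmult_comm gamma alpha); reflexivity. }
assert (Ae0 : 0 <= A / eps) by (apply Rdiv_le_0_compat; lra).
assert (Be0 : 0 <= B / eps) by (apply Rdiv_le_0_compat; lra).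
assert (nn1 : nonneg_state E1) by (rewrite eE1; cbn; lra).
assert (bal1 : balanced lam2 L eps beta1 beta2 A B E1).
{ rewrite eE1; repeat split; try ring; field; lra. }
(* The threshold condition at the equilibrium without customers, where the
   potential referral component is A / eps. *)
assert (etau : L * (A / eps) = tau * d) by (unfold tau; field; lra).
(* An equilibrium with referral customers has R = (tau - 1) d / L. *)
assert (cases : forall c r p q,
  balanced lam2 L eps beta1 beta2 A B (c, r, p, q) ->
  r = 0 \/ (L * q = d /\ L * r = (tau - 1) * d)).
{ intros c r p q [_ [Hr [_ Hq]]].
  apply Rmult_integral in Hr; destruct Hr as [Hr|Hr]; [left; assumption|].
  right; split; [unfold d; lra|].
  assert (r + q = A / eps) by (rewrite <- Hq; field; lra).
  replace r with (A / eps - q) by lra; unfold d in *; lra. }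
rewrite ef; split; intros Htau.
- split.
  + intros E; rewrite is_equilibrium_iff_balanced; split.
    2:{ intros ->; split; assumption. }
    intros [nn bal]; destruct E as [[[c r] p] q].
    assert (r = 0) as ->.
    { destruct (cases _ _ _ _ bal) as [|[_ Hr]]; [assumption|].
      destruct nn as [_ [r0 _]]; nra. }
    rewrite eE1 in *.
    apply (balanced_unique lam2 L eps beta1 beta2 A B); auto; lra.
  + rewrite eE1 in *; apply locally_stable_of_balanced; auto.
    rewrite etau; fold d; nra.
- set (rho := 1 - 1 / tau) in *.
  assert (A0' : 0 < A).
  { destruct A0 as [|A0]; [assumption|exfalso].
    rewrite <- A0 in etau; unfold Rdiv in etau; nra. }
  assert (rho0 : 0 < rho).
  { unfold rho, Rdiv; rewrite Rmult_1_l, <- Rinv_1 at 1.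
    assert (/ tau < / 1) by (apply Rinv_lt_contravar; lra); lra. }
  assert (r20 : 0 < A * rho / eps)
    by (apply Rdiv_lt_0_compat; [apply Rmult_lt_0_compat|]; assumption).
  set (D := eps + beta1 + lam2 * (A / eps) * rho) in *.
  assert (D0 : 0 < D).
  { assert (0 <= lam2 * (A / eps) * rho)
      by (apply Rmult_le_pos; [apply Rmult_le_pos|]; lra).
    unfold D; lra. }
  assert (eE2 : E2 = (lam2 * (A * rho / eps) * (B / eps) / D, A * rho / eps,
                      (eps + beta1) * (B / eps) / D, d / L)).
  { unfold E2; apply f_equal2; [apply f_equal2; [apply f_equal2|]|];
      try reflexivity;
      match goal with |- @eq _ ?u ?v => change (@eq R u v) end;
      unfold A, B; field; lra. }
  assert (nn2 : nonneg_state E2).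
  { rewrite eE2; split; [|split; [lra|split]].
    - apply Rdiv_le_0_compat; [apply Rmult_le_pos; [apply Rmult_le_pos|]|]; lra.
    - apply Rdiv_le_0_compat; [apply Rmult_le_pos|]; lra.
    - apply Rdiv_le_0_compat; lra. }
  assert (bal2 : balanced lam2 L eps beta1 beta2 A B E2).
  { rewrite eE2; split; [|split; [|split]].
    - field; lra.
    - fold d; field; lra.
    - replace (lam2 * (A * rho / eps)) with (D - (eps + beta1))
        by (unfold D; field; lra).
      field; lra.
    - unfold rho, tau; field; lra. }
  split; [|split; [|split]].
  + intros E; rewrite is_equilibrium_iff_balanced; split.
    2:{ intros [->| ->]; split; assumption. }
    intros [nn bal]; destruct E as [[[c r] p] q].
    destruct (cases _ _ _ _ bal) as [->|[_ Hr]].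
    * left; rewrite eE1 in *.
      apply (balanced_unique lam2 L eps beta1 beta2 A B); auto; lra.
    * right; rewrite eE2 in *.
      destruct (cases _ _ _ _ bal2) as [|[_ Hr2]]; [lra|].
      assert (r = A * rho / eps) as -> by (apply Rmult_eq_reg_l with L; lra).
      apply (balanced_unique lam2 L eps beta1 beta2 A B); auto; lra.
  + intros H; apply (f_equal referral) in H; rewrite eE2 in H; cbn in H.
    unfold E1 in H; cbn in H; lra.
  + rewrite eE1; apply referral_free_unstable; auto.
    rewrite etau; fold d; nra.
  + rewrite eE2 in *; apply locally_stable_of_balanced; auto.
    right; unfold d; field; lra.
Qed.
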